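(* Let $(X,f)$ be a dynamical system (with nonempty compact Hausdorff phase space) with $\Phi(\mathcal P(X,f))\neq E$, and let $N\in\Sigma(X,f)$, $N\neq E$. Then there exists $(h,(A,g))\in\mathrm{Ob}\,\mathfrak B_0'(X,f)$ such that $\Phi(\mathcal P(A,g))=N$, and the following statements are equivalent: (i) the object $(h,(A,g))\in\mathrm{Ob}\,\mathfrak B_0'(X,f)$ such that $\Phi(\mathcal P(A,g))=N$ is defined uniquely; (ii) the dynamical system $(X,f)$ is indecomposable.
   Context: Here $\mathbb N=\{1,2,\dots\}$. A dynamical system is a pair $(X,f)$ with $X$ a nonempty compact Hausdorff space and $f:X\to X$ a homeomorphism. A morphism $h:(X,f)\to(Y,g)$ is a continuous map $h:X\to Y$ with $h\circ f=g\circ h$; the category so obtained is $\mathcal K_0$. Topologically conjugate means isomorphic in $\mathcal K_0$. $(X,f)$ is indecomposable if whenever $X=X_1\cup X_2$, $X_1\cap X_2=\emptyset$, with $X_1,X_2$ closed and invariant ($f(X_i)=X_i$), then $X_1=\emptyset$ or $X_2=\emptyset$. A periodic partition of $(X,f)$ of length $m\in\mathbb N$ is a family $\{W_i\}_{i=0}^{m-1}$ of pairwise disjoint open-closed subsets of $X$ with union $X$, such that $f(W_{i-1})=W_i$ for $i=1,\dots,m-1$ and $f(W_{m-1})=W_0$. $\mathcal P(X,f)\subseteq\mathbb N$ is the set of lengths of all periodic partitions of $(X,f)$. An ultranatural number is a family $N=(N_p)_p$ indexed by primes $p$ with $N_p\in\{0,1,2,\dots\}\cup\{\infty\}$; the set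 $\Sigma$ of these is ordered by $M\le N$ iff $M_p\le N_p$ for all $p$, and $E=(0)_p$ is its least element. For nonempty $S\subseteq\mathbb N$, $\Phi(S)\in\Sigma$ is defined by $\Phi(S)_p=\sup\{k\ge 0: p^k \text{ divides some } a\in S\}$. $\Sigma(X,f)=\{N\in\Sigma: N\le\Phi(\mathcal P(X,f))\}$. An odometer: given a sequence $\{n_i\}_{i\in\mathbb N}$ of positive integers with $n_i\mid n_{i+1}$ (bounded sequences allowed), $A=\varprojlim \mathbb Z/n_i\mathbb Z$ (inverse limit of discrete cyclic groups along the maps $1\mapsto 1$, with the inverse limit topology) and $g(\vec a)=\vec a+\vec e$, $\vec e=(1,1,\dots)$; $(A,g)$ is the odometer constructed on $\{n_i\}$. $\mathcal A$ is the full subcategory of $\mathcal K_0$ whose objects are the dynamical systems topologically conjugate to odometers; $\mathcal A(X,f)$ is the full subcategory of $\mathcal A$ of objects $(A,g)$ with $\Phi(\mathcal P(A,g))\le\Phi(\mathcal P(X,f))$. A skeleton of a category is a full subcategory containing exactly one representative of each isomorphism class of objects. $\mathcal A_0(X,f)$ is a fixed skeleton of $\mathcal A(X,f)$. The category $\mathfrak B(X,f)$: objects are pairs $(h,(A,g))$ with $(A,g)$ an object of $\mathcal A(X,f)$ and $h:(X,f)\to(A,g)$ a morphism; morphisms from $(h_1,(A_1,g_1))$ to $(h_2,(A_2,g_2))$ are the (triples given by) morphisms $\pi:(A_1,g_1)\to(A_2,g_2)$ with $h_2=\pi\circ h_1$. $\mathfrak B'(X,f)$ is the full subcategory of $\mathfrak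 B(X,f)$ of objects $(h,(A,g))$ with $(A,g)\in\mathrm{Ob}\,\mathcal A_0(X,f)$, and $\mathfrak B_0'(X,f)$ is a fixed skeleton of $\mathfrak B'(X,f)$. *)

(* Defs.v *)
From HB Require Import structures.
From mathcomp Require Import all_boot all_order all_algebra.
From mathcomp Require Import all_classical all_reals topology.

Set Implicit Arguments.
Unset Strict Implicit.
Unset Printing Implicit Defensive.

Import Order.TTheory GRing.Theory.

Local Open Scope classical_set_scope.

(* [None] is the value oo. *)
Definition enat : Type := option nat.

HB.instance Definition _ := Choice.copy enat (option nat).

Definition le_enat (x y : enat) : bool :=
  match x, y with
  | _, None => true
  | None, Some _ => false
  | Some m, Some n => (m <= n)%N
  end.

Fact le_enat_refl : reflexive le_enat.
Proof. by case=> //= n; exact: leqnn. Qed.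

Fact le_enat_anti : antisymmetric le_enat.
Proof. by case=> [m|] [n|] //= /anti_leq ->. Qed.

Fact le_enat_trans : transitive le_enat.
Proof. by case=> [m|] [n|] [p|] //=; exact: leq_trans. Qed.

Fact enat_display : Order.disp_t. Proof. exact: Order.Disp tt tt. Qed.

HB.instance Definition _ := Order.Le_isPOrder.Build enat_display enat
  le_enat_refl le_enat_anti le_enat_trans.

Definition ultranat : Type := {p : nat | prime p} -> enat.

Definition le_ultranat (M N : ultranat) : Prop := forall p, (M p <= N p)%O.

Definition ultranatE : ultranat := fun=> Some 0.

Definition Phi (S : set nat) : ultranat := fun p =>
  supremum (Some 0 : enat)
    [set (Some k : enat) | k in [set k | exists2 a, S a & val p ^ k %| a]].

Record category := Category {
  Ob :> Type;
  Hom : Ob -> Ob -> Type;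
  cat_id : forall x, Hom x x;
  cat_comp : forall x y z, Hom y z -> Hom x y -> Hom x z;
  cat_compIl : forall x y (u : Hom x y), cat_comp (cat_id y) u = u;
  cat_compIr : forall x y (u : Hom x y), cat_comp u (cat_id x) = u;
  cat_compA : forall x y z t (w : Hom z t) (v : Hom y z) (u : Hom x y),
    cat_comp w (cat_comp v u) = cat_comp (cat_comp w v) u
}.

Definition isomorphic (C : category) (x y : C) : Prop :=
  exists (u : Hom x y) (v : Hom y x),
    cat_comp v u = cat_id x /\ cat_comp u v = cat_id y.

Definition full_subcategory (C : category) (P : C -> Prop) : category :=
  @Category {x : C | P x}
    (fun x y => Hom (sval x) (sval y))
    (fun x => cat_id (sval x))
    (fun x y z v u => cat_comp v u)
    (fun x y u => cat_compIl u)
    (fun x y u => cat_compIr u)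
    (fun x y z t w v u => cat_compA w v u).

(* A skeleton is given by its class of objects, being a full subcategory. *)
Definition is_skeleton (C : category) (S : C -> Prop) : Prop :=
  forall x : C, exists! y : C, S y /\ isomorphic x y.

Definition homeomorphism (X Y : topologicalType) (f : X -> Y) : Prop :=
  exists g : Y -> X,
    [/\ continuous f, continuous g, cancel f g & cancel g f].

Record dynsys := DynSys {
  phase :> topologicalType;
  dmap : phase -> phase;
  phase_nonempty : [set: phase] !=set0;
  phase_compact : compact [set: phase];
  phase_hausdorff : hausdorff_space phase;
  dmap_homeomorphism : homeomorphism dmap
}.

Record morphism (X Y : dynsys) := Morphism {
  mor_fun :> X -> Y;
  mor_continuous : continuous mor_fun;
  mor_commutes : mor_fun \o @dmap X = @dmap Y \o mor_fun
}.

Lemma morphism_eq (X Y : dynsys) (h k : morphism X Y) :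
  mor_fun h = mor_fun k -> h = k.
Proof.
case: h k => [h ch eh] [k ck ek] /= hk; case: _ / hk ck ek => ck ek.
by rewrite (Prop_irrelevance ch ck) (Prop_irrelevance eh ek).
Qed.

Definition mor_id (X : dynsys) : morphism X X :=
  @Morphism X X idfun (fun x => @cvg_id _ (nbhs x)) erefl.

Fact mor_comp_continuous (X Y Z : dynsys)
  (k : morphism Y Z) (h : morphism X Y) : continuous (k \o h).
Proof.
by move=> x; apply: continuous_comp; exact: mor_continuous.
Qed.

Fact mor_comp_commutes (X Y Z : dynsys)
  (k : morphism Y Z) (h : morphism X Y) :
  (k \o h) \o @dmap X = @dmap Z \o (k \o h).
Proof.
rewrite (_ : (k \o h) \o _ = k \o (h \o @dmap X))// mor_commutes.
by rewrite (_ : k \o (_ \o h) = (k \o @dmap Y) \o h)// mor_commutes.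
Qed.

Definition mor_comp (X Y Z : dynsys)
    (k : morphism Y Z) (h : morphism X Y) : morphism X Z :=
  Morphism (@mor_comp_continuous X Y Z k h) (@mor_comp_commutes X Y Z k h).

Definition K0 : category := @Category dynsys morphism mor_id mor_comp
  (fun X Y h => @morphism_eq X Y (mor_comp (mor_id Y) h) h erefl)
  (fun X Y h => @morphism_eq X Y (mor_comp h (mor_id X)) h erefl)
  (fun X Y Z T l k h => @morphism_eq X T
    (mor_comp l (mor_comp k h)) (mor_comp (mor_comp l k) h) erefl).

Definition conjugate (X Y : dynsys) : Prop := @isomorphic K0 X Y.

Definition indecomposable (X : dynsys) : Prop :=
  forall X1 X2 : set X,
    X1 `|` X2 = setT -> X1 `&` X2 = set0 ->
    closed X1 -> closed X2 ->
    @dmap X @` X1 = X1 -> @dmap X @` X2 = X2 ->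
    X1 = set0 \/ X2 = set0.

(* Only the values W i with i < m matter. *)
Record periodic_partition (X : dynsys) (m : nat) (W : nat -> set X) : Prop :=
  PeriodicPartition {
  pp_length : (0 < m)%N;
  pp_clopen : forall i, (i < m)%N -> clopen (W i);
  pp_disjoint : trivIset `I_m W;
  pp_cover : \bigcup_(i in `I_m) W i = setT;
  pp_step : forall i, (0 < i < m)%N -> @dmap X @` W i.-1 = W i;
  pp_last : @dmap X @` W m.-1 = W 0
}.

Definition periods (X : dynsys) : set nat :=
  [set m | exists W, @periodic_partition X m W].

Definition Sigma (X : dynsys) : set ultranat :=
  [set N | le_ultranat N (Phi (periods X))].

Record odometer_seq := OdometerSeq {
  oseq :> nat -> nat;
  oseq_gt0 : forall i, (0 < oseq i)%N;
  oseq_dvd : forall i, oseq i %| oseq i.+1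
}.

Section Odometer.
Variable n : odometer_seq.
Local Open Scope ring_scope.

(* Z/n_i, the library's additive group on 'I_k.+1 with k.+1 = n_i (n_i = 1 is
   allowed, hence not 'Z_(n i)), with the discrete topology. *)
Definition cyc (i : nat) : Type := 'I_(n i).-1.+1.

Definition cyc_prod : topologicalType :=
  prod_topology (fun i => discrete_topology (cyc i)).

(* [inZp : nat -> 'I_k.+1] is reduction mod k.+1, so the condition says that
   the bonding map 1 |-> 1 sends a_(i+1) to a_i. *)
Definition invlim : set cyc_prod :=
  [set a | forall i, inZp (a i.+1 : cyc i.+1) = (a i : cyc i)].

Definition odometer_space : topologicalType := set_type invlim.

(* a |-> a + c (1, 1, ...): the odometer map for c = 1, its inverse for
   c = -1. *)
Definition invlim_add (c : forall i, cyc i) (a : cyc_prod) : cyc_prod :=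
  fun i => (a i : cyc i) + c i.

Definition one_seq (i : nat) : cyc i := inZp 1.
Definition opp_one_seq (i : nat) : cyc i := - inZp 1.

Fact cyc_dvd (i : nat) : ((n i).-1.+1 %| (n i.+1).-1.+1)%N.
Proof. by rewrite !prednK ?oseq_gt0 ?oseq_dvd. Qed.

Fact inZp_add (i : nat) (x y : cyc i.+1) :
  inZp ((x + y)%R : cyc i.+1) = inZp x + inZp y :> cyc i.
Proof.
by apply: val_inj; rewrite /= modn_dvdm ?cyc_dvd// modnDm.
Qed.

Fact inZp_one (i : nat) : inZp (one_seq i.+1) = one_seq i.
Proof. by apply: val_inj; rewrite /= modn_dvdm// cyc_dvd. Qed.

Fact inZp_opp_one (i : nat) : inZp (opp_one_seq i.+1) = opp_one_seq i.
Proof.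
apply: (addrI (one_seq i)); rewrite subrr -inZp_one -inZp_add subrr.
by apply: val_inj; rewrite /= mod0n.
Qed.

Fact invlim_add_subproof (c : forall i, cyc i) (a : odometer_space) :
  (forall i, inZp (c i.+1) = c i) -> invlim_add c (set_val a) \in invlim.
Proof.
have ha : invlim (set_val a) by exact/set_mem/valP.
by move=> hc; apply/mem_set => i /=; rewrite /invlim_add inZp_add ha hc.
Qed.

Definition odometer_map (a : odometer_space) : odometer_space :=
  exist (fun a => a \in invlim) (invlim_add one_seq (set_val a))
    (invlim_add_subproof a inZp_one).

Definition odometer_inv (a : odometer_space) : odometer_space :=
  exist (fun a => a \in invlim) (invlim_add opp_one_seq (set_val a))
    (invlim_add_subproof a inZp_opp_one).

Fact cyc_prod_continuous (T : topologicalType) (h : T -> cyc_prod) :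
  (forall i, continuous (fun t => h t i : discrete_topology (cyc i))) ->
  continuous h.
Proof.
move=> hc t; apply/cvg_sup => i.
exact: (@continuous_comp_initial _ _ _ (fun f : cyc_prod => f i) h (hc i) t).
Qed.

Fact coord_continuous (i : nat) :
  continuous (fun a : cyc_prod => a i : discrete_topology (cyc i)).
Proof. exact: (@proj_continuous _ (fun i => discrete_topology (cyc i)) i). Qed.

Fact discrete_continuous (T : choiceType) (Y : topologicalType)
  (f : discrete_topology T -> Y) : continuous f.
Proof. by apply/continuousP => A _; exact: discrete_open. Qed.

Fact invlim_add_continuous (c : forall i, cyc i) : continuous (invlim_add c).
Proof.
apply: cyc_prod_continuous => i a.
apply: (@continuous_comp cyc_prod (discrete_topology (cyc i))
  (discrete_topology (cyc i)) (fun b => b i) (fun x : cyc i => x + c i)).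
  exact: coord_continuous.
exact: discrete_continuous.
Qed.

Fact set_val_continuous : continuous (set_val : odometer_space -> cyc_prod).
Proof. exact: initial_continuous. Qed.

Fact odometer_map_continuous : continuous odometer_map.
Proof.
apply: (@continuous_comp_initial _ _ _ (set_val : odometer_space -> cyc_prod)).
move=> a; apply: (continuous_comp (@set_val_continuous a)).
exact: invlim_add_continuous.
Qed.

Fact odometer_inv_continuous : continuous odometer_inv.
Proof.
apply: (@continuous_comp_initial _ _ _ (set_val : odometer_space -> cyc_prod)).
move=> a; apply: (continuous_comp (@set_val_continuous a)).
exact: invlim_add_continuous.
Qed.

Fact odometer_homeomorphism : homeomorphism odometer_map.
Proof.
exists odometer_inv; split.
- exact: odometer_map_continuous.
- exact: odometer_inv_continuous.
- move=> a; apply: val_inj; apply: functional_extensionality_dep => i /=.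
  exact: addrK.
- move=> a; apply: val_inj; apply: functional_extensionality_dep => i /=.
  exact: subrK.
Qed.

Fact odometer_nonempty : [set: odometer_space] !=set0.
Proof.
have z : (fun i => 0 : cyc i) \in invlim.
  by apply/mem_set => i; apply: val_inj; rewrite /= mod0n.
by exists (exist (fun a => a \in invlim) _ z).
Qed.

Fact odometer_hausdorff : hausdorff_space odometer_space.
Proof.
move=> a b ab; apply: val_inj.
apply: (@hausdorff_product _ (fun i => discrete_topology (cyc i))) => [i|].
  exact: discrete_hausdorff.
move=> U V aU bV.
have [c [Uc Vc]] := ab _ _ (set_val_continuous aU) (set_val_continuous bV).
by exists (set_val c).
Qed.

Fact invlim_closed : closed invlim.
Proof.
rewrite (_ : invlim = \bigcap_i [set a : cyc_prod |
    inZp (a i.+1 : cyc i.+1) = (a i : cyc i)]); last first.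
  by rewrite eqEsubset; split=> a /= ha i; [move=> _|]; exact: ha.
apply: closed_bigI => i _.
rewrite (_ : [set _ | _] = \bigcup_(x in [set: cyc i.+1])
    ([set a : cyc_prod | a i.+1 = x] `&` [set a : cyc_prod | a i = inZp x]));
  last first.
  rewrite eqEsubset; split=> a /=; first by move=> e; exists (a i.+1).
  by move=> [x _ [-> ->]].
apply: closed_bigcup => [|x _]; first exact: finite_finset.
apply: closedI.
  exact: (preimage_closed (in1W (@coord_continuous i.+1))
    (@discrete_closed (discrete_topology (cyc i.+1)) [set x])).
exact: (preimage_closed (in1W (@coord_continuous i))
  (@discrete_closed (discrete_topology (cyc i)) [set inZp x])).
Qed.

Fact invlim_compact : compact invlim.
Proof.
have cT : compact [set f : cyc_prod |
    forall i, [set: discrete_topology (cyc i)] (f i)].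
  apply: (@tychonoff _ (fun i => discrete_topology (cyc i))
    (fun i => [set: discrete_topology (cyc i)])) => i.
  by apply: finite_compact; exact: finite_finset.
by apply: (subclosed_compact invlim_closed cT).
Qed.

Fact odometer_compact : compact [set: odometer_space].
Proof.
move=> F PF _.
have Finv : F (set_val @^-1` invlim).
  by apply: (filterE (F := F)) => a; exact/set_mem/(svalP a).
have [p [Ap cp]] := invlim_compact (fmap_proper_filter set_val PF) Finv.
exists (exist (fun a => a \in invlim) p (mem_set Ap)); split=> //.
move=> U V FU [W [[O oO <-] Op OV]].
have FsU : F (set_val @^-1` (set_val @` U)).
  by apply: (filterS (F := F)) FU => x Ux; exists x.
have [_ [[x Ux <-] Ox]] := cp _ _ FsU (open_nbhs_nbhs (conj oO Op)).
by exists x; split=> //; exact: OV.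
Qed.

Definition odometer : dynsys :=
  DynSys odometer_nonempty odometer_compact odometer_hausdorff
    odometer_homeomorphism.

End Odometer.

Definition calA : category := full_subcategory (C := K0)
  (fun A : dynsys => exists n : odometer_seq, conjugate A (odometer n)).

Definition calA_over (X : dynsys) : category := full_subcategory (C := calA)
  (fun A => le_ultranat (Phi (periods (sval A))) (Phi (periods X))).

Definition calA_sys (X : dynsys) (A : calA_over X) : dynsys := sval (sval A).

Section Over.
Variable X : dynsys.

Record over_obj := OverObj {
  over_sys : calA_over X;
  over_map : morphism X (calA_sys over_sys)
}.

Record over_hom (b1 b2 : over_obj) := OverHom {
  over_fun :> morphism (calA_sys (over_sys b1)) (calA_sys (over_sys b2));
  over_commutes : over_map b2 = mor_comp over_fun (over_map b1)
}.

Lemma over_hom_eq (b1 b2 : over_obj) (u v : over_hom b1 b2) :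
  over_fun u = over_fun v -> u = v.
Proof.
case: u v => [u hu] [v hv] /= uv; case: _ / uv hv => hv.
by rewrite (Prop_irrelevance hu hv).
Qed.

Definition over_id (b : over_obj) : over_hom b b :=
  @OverHom b b (mor_id _) (esym (cat_compIl (over_map b : Hom (c := K0) _ _))).

Fact over_comp_commutes (b1 b2 b3 : over_obj)
  (v : over_hom b2 b3) (u : over_hom b1 b2) :
  over_map b3 = mor_comp (mor_comp v u) (over_map b1).
Proof. by rewrite (over_commutes v) (over_commutes u); exact: morphism_eq. Qed.

Definition over_comp (b1 b2 b3 : over_obj)
    (v : over_hom b2 b3) (u : over_hom b1 b2) : over_hom b1 b3 :=
  OverHom (over_comp_commutes v u).

Definition frakB : category := @Category over_obj over_hom over_id over_comp
  (fun b1 b2 u => @over_hom_eq b1 b2 (over_comp (over_id b2) u) u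
    (cat_compIl (over_fun u : Hom (c := K0) _ _)))
  (fun b1 b2 u => @over_hom_eq b1 b2 (over_comp u (over_id b1)) u
    (cat_compIr (over_fun u : Hom (c := K0) _ _)))
  (fun b1 b2 b3 b4 w v u => @over_hom_eq b1 b4
    (over_comp w (over_comp v u)) (over_comp (over_comp w v) u)
    (cat_compA (over_fun w : Hom (c := K0) _ _) (over_fun v) (over_fun u))).

(* A0 is the class of objects of a skeleton of calA_over X. *)
Definition frakB' (A0 : calA_over X -> Prop) : category :=
  full_subcategory (C := frakB) (fun b : over_obj => A0 (over_sys b)).

(* B0 is the class of objects of a skeleton of frakB' A0. *)
Definition frakB0' (A0 : calA_over X -> Prop) (B0 : frakB' A0 -> Prop) :
  category := full_subcategory B0.

(* The odometer (A, g) of an object (h, (A, g)) of frakB0' B0. *)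
Definition obj_sys (A0 : calA_over X -> Prop) (B0 : frakB' A0 -> Prop)
  (b : frakB0' B0) : dynsys := calA_sys (over_sys (sval (sval b))).

End Over.

(* Main.v *)
From HB Require Import structures.
Require Import Defs.
From mathcomp Require Import all_boot all_order all_algebra zify.
From mathcomp Require Import all_classical all_reals topology.

Set Implicit Arguments.
Unset Strict Implicit.
Unset Printing Implicit Defensive.

Import Order.TTheory.

Local Open Scope classical_set_scope.

(** A periodic partition of length m is the same thing as a phase: a locally
constant map phi : X -> nat which the dynamics increases by one modulo m.
Phases restrict to divisors of m and combine, by the Chinese remainder theorem,
for coprime lengths. Hence the set of periods is recovered from its ultranatural
number: m is a period of X exactly when every prime exponent of m is bounded by
Phi (periods X) ([mem_periods]).

A morphism from X to the odometer on n is a compatible family of phases of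
lengths n_0, n_1, and so on. If every n_i is a period of X such a family can be
built by induction, correcting a phase of length n_(i+1) by an invariant term so
that it lifts the phase of length n_i; moreover the image of one point can be
prescribed ([morphism_to_odometer]). Taking for n_i the lcm of the divisors of
N that are at most i gives an odometer with ultranatural number N, which X maps
to as soon as N <= Phi (periods X). This is existence.

Two morphisms into an odometer differ by a locally constant invariant function
in each coordinate, so on an indecomposable system they are equal as soon as
they agree at one point. Odometers themselves are indecomposable, every orbit
being dense. So, if X is indecomposable, any two objects (h1, A1) and (h2, A2)
with the same ultranatural number are isomorphic: take the morphisms
A1 -> A2 and A2 -> A1 matching the images of one point of X; they commute with
h1 and h2, and their composites fix a point, hence are identities.

If X splits into two nonempty closed invariant pieces, apply h on one and g h
on the other. An isomorphism from (h, A) to this new object fixes a point, so it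
is the identity, hence g fixes a point of A; all periods of A would then be 1,
while N is not trivial. So two non-isomorphic objects have the ultranatural
number N.

The skeletons only serve to turn isomorphism into equality
([skeleton_representative], [skeleton_eq]). *)

(** * Ultranatural numbers of sets of integers *)

Lemma exponents_have_supremum (S : set nat) (p : {p : nat | prime p}) :
  supremums [set (Some k : enat) |
    k in [set k | exists2 a, S a & val p ^ k %| a]] !=set0.
Proof.
set T := [set k | _].
have [[M TM]|unbT] := pselect (exists M, forall k, T k -> k <= M); last first.
  exists None; split; first by move=> x _; case: x.
  move=> [M|] //= ubM; exfalso; apply: unbT; exists M => k Tk.
  by have := ubM (Some k) (ex_intro2 _ _ k Tk erefl).
have [T0|/set0P [k0 Tk0]] := eqVneq T set0.
  exists (Some 0); split; first by move=> x [k]; rewrite T0.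
  by case.
have exT : exists k, `[<T k>] by exists k0; apply/asboolP.
have [k /asboolP Tk kmax] := ex_maxnP exT (fun k Tk => TM k (asboolW Tk)).
exists (Some k); split; last by move=> x; apply; exists k.
by move=> _ [l Tl <-]; apply: kmax; apply/asboolP.
Qed.

(** [Phi] enters the rest of the argument only through this finite
characterization: an exponent k lies below the supremum iff it is attained. *)
Lemma le_Phi (S : set nat) (p : {p : nat | prime p}) k : S !=set0 ->
  (Some k <= Phi S p :> enat)%O <-> exists2 a, S a & val p ^ k %| a.
Proof.
move=> [a0 Sa0]; rewrite /Phi.
set T := [set (_ : enat) | _ in _].
have sT : supremums T (supremum (Some 0 : enat) T).
  rewrite /supremum; case: ifPn => [/eqP T0|_].
    exfalso; have : T (Some 0) by exists 0 => //; exists a0; rewrite ?dvd1n.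
    by rewrite T0.
  have [x Tx] := exponents_have_supremum S p.
  by case: xgetP => [y _ //|/(_ x)].
case: sT; set s := supremum _ _ => ubs lubs; split=> [ks|Sk]; last first.
  by apply: ubs; exists k.
have [//|nSk] := pselect (exists2 a, S a & val p ^ k %| a).
exfalso; case: k => [|k] in ks nSk.
  by apply: nSk; exists a0; rewrite ?dvd1n.
have /lubs : ubound T (Some k).
  move=> _ [l [a Sa la] <-] /=; rewrite /Order.le /=.
  rewrite leqNgt; apply/negP => kl.
  by apply: nSk; exists a => //; apply: dvdn_trans la; exact: dvdn_exp2l.
by move=> /(le_trans ks); rewrite /Order.le /= ltnn.
Qed.

Lemma le_enatP (x y : enat) :
  (forall k, (Some k <= x :> enat)%O -> (Some k <= y :> enat)%O) -> (x <= y)%O.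
Proof.
case: y => [n|]; last by case: x.
case: x => [m|] /=; first by apply.
by move=> /(_ n.+1 isT); rewrite /Order.le /= ltnn.
Qed.

(** An element satisfying the exponent bounds is a product of prime powers, each
dividing some element of P; split them off one at a time. *)
Lemma ideal_le_Phi (P : set nat) :
  P 1 -> (forall m, P m -> 0 < m) ->
  (forall m d, d %| m -> P m -> P d) ->
  (forall m d, coprime m d -> P m -> P d -> P (m * d)) ->
  forall m, P m <->
    0 < m /\ forall p : {p : nat | prime p},
      (Some (logn (val p) m) <= Phi P p :> enat)%O.
Proof.
move=> P1 Ppos Pdvd Pmul m; have P0 : P !=set0 by exists 1.
split=> [Pm|[]].
  split=> [|p]; first exact: Ppos.
  by apply/le_Phi => //; exists m => //; exact: pfactor_dvdnn.
have [k] := ubnP m; elim: k m => // k IH m; rewrite ltnS => mk m0 mP.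
have [m1|m1] := leqP m 1.
  by have -> : m = 1 by lia.
set p := pdiv m; have pp : prime p by exact: pdiv_prime.
have [m' cpm' Em] := pfactor_coprime pp m0.
have l0 : 0 < logn p m by rewrite logn_gt0 mem_primes pp m0 pdiv_dvd.
have m'0 : 0 < m' by move: m0; rewrite Em muln_gt0 => /andP[].
rewrite Em; apply: Pmul; first by rewrite coprime_sym coprimeXl.
  apply: IH => // [|q].
    apply: leq_trans mk; rewrite [leqRHS]Em ltn_Pmulr//.
    by rewrite -(exp1n (logn p m)) ltn_exp2r// prime_gt1.
  apply: le_trans (mP q); rewrite /Order.le /=.
  by apply: dvdn_leq_log => //; rewrite Em dvdn_mulr.
by have [a Pa da] := (le_Phi (exist _ p pp) _ P0).1 (mP (exist _ p pp));
  exact: Pdvd da Pa.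
Qed.

(** * Phases *)

(** Values are taken in nat and compared modulo m, rather than in Z/m, so that
one function can serve as a phase for several moduli. *)
Definition phase_map (X : dynsys) (m : nat) (phi : X -> nat) : Prop :=
  (forall x, \forall y \near x, phi y = phi x) /\
  (forall x, phi (dmap x) = (phi x).+1 %[mod m]).

Lemma modnS_eq m a b : a.+1 = b.+1 %[mod m] <-> a = b %[mod m].
Proof.
by rewrite -(addn1 a) -(addn1 b); split=> /eqP ab; apply/eqP; move: ab;
  rewrite eqn_modDr.
Qed.

Section Phases.
Variable X : dynsys.
Implicit Types (m d : nat) (phi : X -> nat).

Lemma phase_map_iter m phi x k :
  phase_map m phi -> phi (iter k (@dmap X) x) = phi x + k %[mod m].
Proof.
move=> [_ phiS]; elim: k => [|k IH]; first by rewrite addn0.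
by rewrite /= phiS addnS; exact/modnS_eq.
Qed.

Lemma dmap_surj (y : X) : exists x, @dmap X x = y.
Proof. by have [g [_ _ _ gK]] := dmap_homeomorphism X; exists (g y). Qed.

Lemma periods_phase m :
  periods X m <-> 0 < m /\ exists phi, @phase_map X m phi.
Proof.
split=> [[W [m0 clW trW covW stepW lastW]]|[m0 [phi [phiC phiS]]]].
  split=> //.
  have /choice[phi phiP] : forall x, exists i, i < m /\ W i x.
    move=> x; have : [set: X] x by [].
    by rewrite -covW => -[i im Wix]; exists i.
  have phiU x i : i < m -> W i x -> phi x = i.
    move=> im Wix; have [pm Wpx] := phiP x.
    by apply: trW => //; exists x.
  exists phi; split=> x; have [pm Wpx] := phiP x.
    have : nbhs x (W (phi x)).
      by apply: open_nbhs_nbhs; split=> //; case: (clW _ pm).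
    by apply: filterS => y; exact: phiU.
  have [pm'|pm'] := ltnP (phi x).+1 m.
    by congr (_ %% _); apply: phiU => //; rewrite -stepW//; exists x.
  have Em : (phi x).+1 = m by lia.
  rewrite Em modnn (phiU _ 0) ?mod0n// -lastW.
  by exists x => //; rewrite -Em.
(* The partition into the level sets of phi modulo m. *)
exists (fun i => [set x | phi x = i %[mod m]]).
have stepW i : i.+1 <= m ->
    @dmap X @` [set x | phi x = i %[mod m]] = [set x | phi x = i.+1 %[mod m]].
  move=> im; rewrite eqEsubset; split=> y /=.
    by move=> [x /= xi <-]; rewrite phiS; exact/modnS_eq.
  move=> yi; have [x xy] := dmap_surj y; exists x => //=.
  by move: yi; rewrite -xy phiS => /modnS_eq.
have opW (A : set nat) : open [set x | A (phi x)].
  rewrite openE => x /= Ax; move: (phiC x); apply: filterS => y yx /=.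
  by rewrite yx.
split=> //.
- move=> i im; split; first exact: (opW [set j | j = i %[mod m]]).
  rewrite -openC (_ : ~` _ = [set x | phi x <> i %[mod m]])//.
  exact: (opW [set j | j <> i %[mod m]]).
- move=> i j /= im jm [x [/= ->]]; rewrite !modn_small//.
- rewrite eqEsubset; split=> // x _; exists (phi x %% m) => /=.
    by rewrite /mkset ltn_mod.
  by rewrite modn_mod.
- by move=> [|i] // /andP[_ im]; rewrite /= stepW// ltnW.
- by rewrite stepW ?prednK// modnn; apply: eq_set => x; rewrite mod0n.
Qed.

Lemma phase_map_dvd d m phi : d %| m -> phase_map m phi -> phase_map d phi.
Proof.
move=> dm [phiC phiS]; split=> // x.
by rewrite -(modn_dvdm (phi (dmap x)) dm) phiS modn_dvdm.
Qed.

Lemma periods1 : periods X 1.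
Proof.
apply/periods_phase; split=> //.
exists (fun=> 0); split=> x; last by rewrite !modn1.
exact: nearW.
Qed.

Lemma periods_gt0 m : periods X m -> 0 < m.
Proof. by move=> /periods_phase[]. Qed.

Lemma periods_dvd m d : d %| m -> periods X m -> periods X d.
Proof.
move=> dm /periods_phase[m0 [phi phiP]]; apply/periods_phase; split.
  exact: dvdn_gt0 dm.
by exists phi; exact: phase_map_dvd phiP.
Qed.

Lemma periods_coprime m d :
  coprime m d -> periods X m -> periods X d -> periods X (m * d).
Proof.
move=> cmd /periods_phase[m0 [phi [phiC phiS]]].
move=> /periods_phase[d0 [psi [psiC psiS]]].
apply/periods_phase; split; first by rewrite muln_gt0 m0.
exists (fun x => chinese m d (phi x) (psi x)); split=> x.
  by apply: filterS2 (phiC x) (psiC x) => y -> ->.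
apply/eqP; rewrite chinese_remainder// -addn1; apply/andP; split; apply/eqP.
  by rewrite addn1 chinese_modl// phiS; apply/modnS_eq; rewrite chinese_modl.
by rewrite addn1 chinese_modr// psiS; apply/modnS_eq; rewrite chinese_modr.
Qed.

(** Since this depends on X only through Phi (periods X), two systems with the
same ultranatural number have the same periods. *)
Lemma mem_periods m :
  periods X m <->
  0 < m /\ forall p : {p : nat | prime p},
    (Some (logn (val p) m) <= Phi (periods X) p :> enat)%O.
Proof.
exact: (ideal_le_Phi periods1 periods_gt0 periods_dvd periods_coprime).
Qed.

End Phases.

Lemma phase_map_comp (X Y : dynsys) m (phi : Y -> nat) (h : morphism X Y) :
  phase_map m phi -> phase_map m (phi \o h).
Proof.
move=> [phiC phiS]; split=> x /=.
  have := phiC (h x); exact: (@mor_continuous _ _ h x).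
by have /= -> := congr1 (fun F => F x) (mor_commutes h).
Qed.

Lemma periods_morphism (X Y : dynsys) :
  morphism X Y -> periods Y `<=` periods X.
Proof.
move=> h m /periods_phase[m0 [phi phiP]]; apply/periods_phase; split=> //.
by exists (phi \o h); exact: phase_map_comp.
Qed.

Lemma periods_subset (X Y : dynsys) :
  le_ultranat (Phi (periods Y)) (Phi (periods X)) -> periods Y `<=` periods X.
Proof.
move=> YX m /mem_periods[m0 mY]; apply/mem_periods; split=> // p.
exact: le_trans (mY p) (YX p).
Qed.

(** At a fixed point the phase is congruent to its successor. *)
Lemma periods_fixed_point (X : dynsys) (x : X) m :
  dmap x = x -> periods X m -> m = 1.
Proof.
move=> fx /periods_phase[m0 [phi [_ /(_ x)]]].
rewrite fx -addn1 -{1}[phi x]addn0 => /eqP; rewrite eqn_modDl mod0n eq_sym.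
by rewrite -/(_ %| _) dvdn1 => /eqP.
Qed.

Lemma shift_phase_map (X : dynsys) m (x0 : X) k : periods X m ->
  exists2 phi, @phase_map X m phi & phi x0 = k %[mod m].
Proof.
move=> /periods_phase[m0 [phi [phiC phiS]]].
(* Adding m.-1 times phi x0 subtracts phi x0 modulo m. *)
exists (fun x => phi x + (m.-1 * phi x0 + k)); last first.
  by rewrite addnA -mulSn prednK// mulnC modnMDl.
split=> x; first by apply: filterS (phiC x) => y ->.
by rewrite -modnDml phiS modnDml.
Qed.

(** * Odometers *)

Section Coordinates.
Variable n : odometer_seq.

Definition coord (i : nat) (a : odometer n) : nat :=
  (set_val (a : odometer_space n) i : cyc n i).

Lemma oseq_dvd_le i j : i <= j -> n i %| n j.
Proof.
elim: j => [|j IH]; first by rewrite leqn0 => /eqP ->.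
rewrite leq_eqVlt => /predU1P[-> //|]; rewrite ltnS => /IH ij.
exact: dvdn_trans ij (oseq_dvd n j).
Qed.

Lemma coord_lt i (a : odometer n) : coord i a < n i.
Proof.
have := ltn_ord (set_val (a : odometer_space n) i : cyc n i).
by rewrite [X in _ < X -> _]prednK ?oseq_gt0.
Qed.

Lemma coord_inj (a b : odometer n) : (forall i, coord i a = coord i b) -> a = b.
Proof.
move=> ab; apply: val_inj; apply: functional_extensionality_dep => i.
by apply: val_inj; exact: ab.
Qed.

Lemma coord_eq_mod i (a b : odometer n) :
  coord i a = coord i b %[mod n i] -> coord i a = coord i b.
Proof. by rewrite !modn_small ?coord_lt. Qed.

Lemma coord_le i j (a : odometer n) :
  i <= j -> coord j a = coord i a %[mod n i].
Proof.
elim: j => [|j IH]; first by rewrite leqn0 => /eqP ->.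
rewrite leq_eqVlt => /predU1P[-> //|]; rewrite ltnS => ij; rewrite -(IH ij).
have /(congr1 val) /= := set_mem (valP (a : odometer_space n)) j.
move=> aj; rewrite -(modn_dvdm (coord j.+1 a) (oseq_dvd_le ij)).
by congr (_ %% _); rewrite -[X in _ %% X]prednK ?oseq_gt0.
Qed.

Lemma coord_eq_le i j (a b : odometer n) :
  i <= j -> coord j a = coord j b -> coord i a = coord i b.
Proof.
by move=> ij ab; apply: coord_eq_mod; rewrite -!(coord_le _ ij) ab.
Qed.

Lemma coord_phase i : phase_map (n i) (coord i).
Proof.
split=> a; last first.
  have -> : coord i (dmap a) =
    (coord i a + 1 %% (n i).-1.+1) %% (n i).-1.+1 by [].
  by rewrite prednK ?oseq_gt0// modnDmr addn1 modn_mod.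
have : nbhs ((set_val (a : odometer_space n) : cyc_prod n) i :
    discrete_topology (cyc n i))
    [set (set_val (a : odometer_space n) : cyc_prod n) i].
  by apply: open_nbhs_nbhs; split=> //; exact: discrete_open.
move=> /(@coord_continuous n i) /(@set_val_continuous n a).
apply: (@filterS _ (nbhs (a : odometer_space n))) => b /= ba.
by rewrite /coord ba.
Qed.

(** Coordinate i determines all lower ones, so the cylinders at a single
coordinate form a neighbourhood base: otherwise points outside U agreeing with b
at ever higher coordinates would converge to b. *)
Lemma nbhs_coord (b : odometer n) (U : set (odometer n)) : nbhs b U ->
  exists i, forall a, coord i a = coord i b -> U a.
Proof.
move=> [_ [[O oO <-] Ob OU]].
have [//|nex] := pselect (exists i, forall a, coord i a = coord i b -> U a).
exfalso.
have /choice[u uP] : forall i, exists a, coord i a = coord i b /\ ~ U a.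
  move=> i; have [//|nea] := pselect (exists a, coord i a = coord i b /\ ~ U a).
  exfalso; apply: nex; exists i => a ab.
  by have [//|nUa] := pselect (U a); exfalso; apply: nea; exists a.
have : (fun i => set_val (u i : odometer_space n) : cyc_prod n) @ \oo -->
    (set_val (b : odometer_space n) : cyc_prod n).
  apply/cvg_sup => i V /=.
  move=> [_ [[W _ <-] /= Wb WV]].
  exists i => // j /= ij; apply: WV => /=.
  suff -> : (set_val (u j : odometer_space n) : cyc_prod n) i =
    (set_val (b : odometer_space n) : cyc_prod n) i by [].
  by apply: val_inj; apply: (coord_eq_le ij); case: (uP j).
move=> /(_ O (open_nbhs_nbhs (conj oO Ob)))[N _ /(_ N (leqnn N))] /= ON.
by case: (uP N) => _; apply; exact: OU.
Qed.

Lemma orbit_dense (a b : odometer n) (U : set (odometer n)) : nbhs b U ->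
  exists k, U (iter k (@dmap (odometer n)) a).
Proof.
move=> /nbhs_coord[i iU]; exists ((n i - coord i a) + coord i b); apply: iU.
apply: coord_eq_mod; rewrite (phase_map_iter _ _ (coord_phase i)) addnA subnKC.
  by rewrite modnDl.
by rewrite ltnW ?coord_lt.
Qed.

(** If phi is a phase of length m, then the n_i-th iterate of b is so close to b,
for i large, that phi takes the same value on both; hence m divides n_i. *)
Lemma periods_odometer m :
  periods (odometer n) m <-> exists i, m %| n i.
Proof.
split=> [/periods_phase[m0 [phi phiP]]|[i mi]]; last first.
  apply/(periods_dvd mi)/periods_phase; split; first exact: oseq_gt0.
  by exists (coord i); exact: coord_phase.
have [b _] := odometer_nonempty n.
have [i /(_ (iter (n i) (@dmap (odometer n)) b)) phib] := nbhs_coord (phiP.1 b).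
exists i.
have : phi (iter (n i) (@dmap (odometer n)) b) = phi b.
  apply: phib; apply: coord_eq_mod.
  by rewrite (phase_map_iter _ _ (coord_phase i)) modnDr.
move=> /(congr1 (modn^~ m)); rewrite (phase_map_iter _ _ phiP).
by rewrite -{2}[phi b]addn0 => /eqP; rewrite eqn_modDl mod0n.
Qed.

Lemma iter_invariant (X : dynsys) (A : set X) :
  @dmap X @` A = A -> forall k x, A x -> A (iter k (@dmap X) x).
Proof.
move=> fA; elim=> // k IH x Ax; rewrite /= -fA.
by exists (iter k (@dmap X) x) => //; exact: IH.
Qed.

Lemma odometer_indecomposable : indecomposable (odometer n).
Proof.
move=> A B AB disjAB cA cB fA fB.
have [->|/set0P[a Aa]] := eqVneq A set0; first by left.
have [->|/set0P[b Bb]] := eqVneq B set0; first by right.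
have /(orbit_dense a)[k] : nbhs b (~` A).
  apply: open_nbhs_nbhs; split; first exact: closed_openC.
  by move=> Ab; have : set0 b by rewrite -disjAB.
by move=> /(_ (iter_invariant fA k Aa)).
Qed.

(** The universal property of the inverse limit: compatible phases of lengths
n_i define a morphism. *)
Lemma odometer_corec (X : dynsys) (theta : nat -> X -> nat) :
  (forall i, phase_map (n i) (theta i)) ->
  (forall i x, theta i.+1 x = theta i x %[mod n i]) ->
  exists h : morphism X (odometer n),
    forall x i, coord i (h x) = theta i x %% n i.
Proof.
move=> thetaP thetaS.
pose h0 x : cyc_prod n := fun i => inZp (theta i x) : cyc n i.
have h0P x : h0 x \in invlim (n := n).
  apply/mem_set => i; apply: val_inj => /=.
  rewrite modn_dvdm ?cyc_dvd//; have := thetaS i x.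
  by rewrite prednK ?oseq_gt0.
pose h x : odometer n := exist (fun a => a \in invlim (n := n)) (h0 x) (h0P x).
have hc : continuous (h : X -> odometer_space n).
  apply: (@continuous_comp_initial _ _ _
    (set_val : odometer_space n -> cyc_prod n)).
  apply: cyc_prod_continuous => i x V /= Vx.
  have := (thetaP i).1 x; apply: filterS => y yx.
  have Exy : h0 y i = h0 x i by rewrite /h0 yx.
  rewrite -[_ y]/(V (h0 y i)) Exy; exact: nbhs_singleton Vx.
have hf : h \o @dmap X = @dmap (odometer n) \o h.
  apply: funext => x; apply: coord_inj => i.
  rewrite /coord /= modnDmr modnDml addn1.
  by have := (thetaP i).2 x; rewrite prednK ?oseq_gt0.
exists (@Morphism X (odometer n) h hc hf) => x i.
by rewrite /coord /= prednK ?oseq_gt0.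
Qed.

(** Start from phases phi_i of length n_i with the prescribed value at x0. The
difference between an already constructed theta_i and phi_(i+1), reduced modulo
n_i, is invariant under the dynamics, so adding it to phi_(i+1) yields a phase of
length n_(i+1) lifting theta_i. It vanishes at x0, so the value there stays as
prescribed. *)
Lemma morphism_to_odometer (X : dynsys) (x0 : X) (b : odometer n) :
  (forall i, periods X (n i)) ->
  exists h : morphism X (odometer n), h x0 = b.
Proof.
move=> Xn.
have /choice[phi phiP] i : exists phi, @phase_map X (n i) phi /\
    phi x0 = coord i b %[mod n i].
  by have [phi] := shift_phase_map x0 (coord i b) (Xn i); exists phi.
(* The residue of t - s modulo n_i. *)
pose corr i (t s : X -> nat) x := (t x + (n i).-1 * s x) %% n i.
pose fix theta i : X -> nat :=
  if i is j.+1 then fun x => phi j.+1 x + corr j (theta j) (phi j.+1) x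
  else phi 0.
have phiP' j : phase_map (n j) (phi j.+1).
  exact: phase_map_dvd (oseq_dvd n j) (phiP j.+1).1.
have thetaP i : phase_map (n i) (theta i).
  elim: i => [|i IH]; first by case: (phiP 0).
  have [phiC phiS] := (phiP i.+1).1.
  split=> x /=.
    by rewrite /corr; apply: filterS2 (phiC x) (IH.1 x) => y -> ->.
  have -> : corr i (theta i) (phi i.+1) (dmap x) =
      corr i (theta i) (phi i.+1) x.
    rewrite /corr -modnDml IH.2 modnDml -modnDmr -modnMmr (phiP' i).2.
    rewrite modnMmr modnDmr.
    by rewrite mulnS addSnnS -addSn prednK ?oseq_gt0// addnCA modnDl.
  by rewrite -modnDml phiS modnDml.
have corrE i (t s : X -> nat) x : s x + corr i t s x = t x %[mod n i].
  rewrite /corr modnDmr addnCA -mulSn prednK ?oseq_gt0// addnC.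
  by rewrite mulnC modnMDl.
have [h hE] := odometer_corec thetaP
  (fun i x => corrE i (theta i) (phi i.+1) x).
exists h; apply: coord_inj => i; apply: coord_eq_mod; rewrite hE modn_mod.
elim: i => [|i IH]; first exact: (phiP 0).2.
suff c0 : corr i (theta i) (phi i.+1) x0 = 0.
  by rewrite /= c0 addn0; exact: (phiP i.+1).2.
have := corrE i (theta i) (phi i.+1) x0; rewrite IH -(coord_le b (leqnSn i)).
have <- : phi i.+1 x0 = coord i.+1 b %[mod n i].
  have := congr1 (modn^~ (n i)) (phiP i.+1).2.
  by rewrite !modn_dvdm ?oseq_dvd.
rewrite -{2}[phi i.+1 x0]addn0 => /eqP; rewrite eqn_modDl mod0n => /eqP.
by rewrite /corr modn_mod.
Qed.

End Coordinates.

(** A locally constant invariant predicate cuts X into two closed invariant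
pieces. *)
Lemma indecomposable_constant (X : dynsys) (P : set X) (x0 : X) :
  indecomposable X ->
  (forall x, \forall y \near x, P y <-> P x) ->
  (forall x, P (dmap x) <-> P x) -> P x0 -> P = setT.
Proof.
move=> indX PC PS Px0.
have opP (Q : set X) : (forall x, \forall y \near x, Q y <-> Q x) -> open Q.
  move=> QC; rewrite openE => x Qx; have := QC x.
  by apply: filterS => y [_]; apply.
have oCP : open (~` P).
  by apply: opP => x; apply: filterS (PC x) => y /not_iff_compat.
have inv (Q : set X) : (forall x, Q (dmap x) <-> Q x) -> @dmap X @` Q = Q.
  move=> QS; rewrite eqEsubset; split=> x; first by move=> [y Qy <-]; apply/QS.
  by have [y <-] := dmap_surj x => /QS Qy; exists y.
have cP : closed P by rewrite -openC.
have [P0|CP0] := indX P (~` P) (setUv P) (setICr P) cP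
  (open_closedC (opP _ PC)) (inv _ PS) (inv _ (fun x => not_iff_compat (PS x))).
  by have : set0 x0 by rewrite -P0.
by rewrite -[P]setCK CP0 setC0.
Qed.

(** Agreement in coordinate i is a locally constant invariant predicate. *)
Lemma morphism_odometer_eq (X : dynsys) (n : odometer_seq)
    (h k : morphism X (odometer n)) (x0 : X) :
  indecomposable X -> h x0 = k x0 -> h = k.
Proof.
move=> indX hk; apply: morphism_eq; apply: funext => x; apply: coord_inj => i.
pose P := [set x | coord i (h x) = coord i (k x)].
suff PT : P = setT by have : [set: X] x by []; rewrite -PT.
have [hC hS] := phase_map_comp h (coord_phase n i).
have [kC kS] := phase_map_comp k (coord_phase n i).
have hkE y : P y <-> coord i (h y) = coord i (k y) %[mod n i].
  by split=> [->|/coord_eq_mod].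
apply: (@indecomposable_constant _ _ x0) => // [{}x|{}x|].
- by apply: filterS2 (hC x) (kC x) => y; rewrite /P /= => -> ->.
- rewrite !hkE -[coord i (h _)]/((coord i \o h) _) hS.
  by rewrite -[coord i (k _)]/((coord i \o k) _) kS modnS_eq.
- by rewrite /P /= hk.
Qed.

(** * The odometer of an ultranatural number *)

Section PrescribedPhi.
Variable N : ultranat.

Definition udivisors : set nat := [set d | 0 < d /\
  forall p : {p : nat | prime p}, (Some (logn (val p) d) <= N p :> enat)%O].

Lemma enat_ge0 (x : enat) : (Some 0 <= x :> enat)%O.
Proof. by case: x. Qed.

Lemma udivisors_dvd m d : d %| m -> udivisors m -> udivisors d.
Proof.
move=> dm [m0 mN]; split=> [|p]; first exact: dvdn_gt0 dm.
by apply: le_trans (mN p); exact: dvdn_leq_log.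
Qed.

Lemma udivisors_lcm m d : udivisors m -> udivisors d -> udivisors (lcmn m d).
Proof.
move=> [m0 mN] [d0 dN]; split=> [|p]; first by rewrite lcmn_gt0 m0.
by rewrite logn_lcm// /maxn; case: ifP.
Qed.

Lemma udivisors_exp (p : {p : nat | prime p}) k :
  (Some k <= N p :> enat)%O -> udivisors (val p ^ k).
Proof.
move=> kN; split=> [|q]; first by rewrite expn_gt0 prime_gt0//; exact: (valP p).
rewrite lognX logn_prime ?(valP p)//; have [qp|_] := eqVneq.
  by rewrite muln1 (val_inj qp).
by rewrite muln0 enat_ge0.
Qed.

(** Every divisor d of N divides [useq d], and [useq i] is itself a divisor of N,
so N is the least common multiple of this sequence. *)
Definition useq (i : nat) : nat :=
  \big[lcmn/1]_(d < i.+1 | `[< udivisors d >]) d.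

Lemma udivisors_useq i : udivisors (useq i).
Proof.
apply: (big_ind udivisors) => [||d /asboolP//]; last exact: udivisors_lcm.
by split=> // p; rewrite logn1 enat_ge0.
Qed.

Lemma dvdn_useq d : udivisors d -> d %| useq d.
Proof.
by move=> dN; rewrite /useq big_mkcond big_ord_recr /= asboolT// dvdn_lcmr.
Qed.

Lemma useq_dvd i : useq i %| useq i.+1.
Proof.
rewrite /useq big_mkcond [X in _ %| X]big_mkcond.
by rewrite [X in _ %| X]big_ord_recr /= dvdn_lcml.
Qed.

Definition uodometer : odometer_seq :=
  OdometerSeq (fun i => (udivisors_useq i).1) useq_dvd.

Lemma Phi_uodometer : Phi (periods (odometer uodometer)) = N.
Proof.
have P0 : periods (odometer uodometer) !=set0 by exists 1; exact: periods1.
apply: funext => p; apply/eqP; rewrite eq_le; apply/andP; split;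
  apply: le_enatP => k.
  move=> /(le_Phi _ _ P0)[a /periods_odometer[i ai] pa].
  have [_ /(_ p)] := udivisors_dvd (dvdn_trans pa ai) (udivisors_useq i).
  by rewrite pfactorK//; exact: (valP p).
move=> /udivisors_exp /dvdn_useq pk; apply/(le_Phi _ _ P0).
by exists (val p ^ k) => //; apply/periods_odometer; exists (val p ^ k).
Qed.

End PrescribedPhi.

(** * Systems conjugate to odometers *)

Definition odometer_like (A : dynsys) : Prop :=
  exists n : odometer_seq, conjugate A (odometer n).

Lemma odometer_like_morphism_eq (X A : dynsys) (h k : morphism X A) (x0 : X) :
  odometer_like A -> indecomposable X -> h x0 = k x0 -> h = k.
Proof.
move=> [n [u [v [vu _]]]] indX hk.
have uhk : mor_comp u h = mor_comp u k.
  by apply: (morphism_odometer_eq (x0 := x0)) => //=; rewrite hk.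
apply: morphism_eq; apply: funext => x.
have vuK a : v (u a) = a := congr1 (fun w : morphism A A => w a) vu.
rewrite -[h x]vuK -[k x]vuK.
by have /= -> := congr1 (fun w : morphism X (odometer n) => w x) uhk.
Qed.

(** Up to conjugacy, the source is an odometer and hence indecomposable. *)
Lemma odometer_like_rigid (A B : dynsys) (h k : morphism A B) (a : A) :
  odometer_like A -> odometer_like B -> h a = k a -> h = k.
Proof.
move=> [n [u [v [vu _]]]] odB hk.
have vuK x : v (u x) = x := congr1 (fun w : morphism A A => w x) vu.
have hkv : mor_comp h v = mor_comp k v.
  apply: (odometer_like_morphism_eq (x0 := u a)) => //=; last by rewrite vuK.
  exact: odometer_indecomposable.
apply: morphism_eq; apply: funext => x; rewrite -[x]vuK.
exact: (congr1 (fun w : morphism (odometer n) B => w (u x)) hkv).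
Qed.

Lemma morphism_to_odometer_like (X A : dynsys) (x : X) (a : A) :
  odometer_like A -> le_ultranat (Phi (periods A)) (Phi (periods X)) ->
  exists h : morphism X A, h x = a.
Proof.
move=> [n [u [v [vu _]]]] AX.
have [i|h hx] := @morphism_to_odometer n X x (u a).
  apply: (periods_subset AX); apply: (periods_morphism u).
  by apply/periods_odometer; exists i.
exists (mor_comp v h); rewrite /= hx.
exact: (congr1 (fun w : morphism A A => w a) vu).
Qed.

Lemma Phi_fixed_point (X : dynsys) (x : X) :
  dmap x = x -> Phi (periods X) = ultranatE.
Proof.
move=> fx; apply: funext => p; apply/eqP; rewrite eq_le enat_ge0 andbT.
have P0 : periods X !=set0 by exists 1; exact: periods1.
apply: le_enatP => k /(le_Phi _ _ P0)[m /(periods_fixed_point fx) ->].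
rewrite dvdn1 -(expn0 (val p)) eqn_exp2l; first by move=> /eqP ->.
exact/prime_gt1/(valP p).
Qed.

Lemma glue_morphism (X A : dynsys) (X1 X2 : set X) (h k : morphism X A) :
  X1 `|` X2 = setT -> X1 `&` X2 = set0 -> closed X1 -> closed X2 ->
  @dmap X @` X1 = X1 -> @dmap X @` X2 = X2 ->
  exists l : morphism X A,
    (forall x, X1 x -> l x = h x) /\ (forall x, X2 x -> l x = k x).
Proof.
move=> X12 dis c1 c2 f1 f2.
pose l x := if `[< X1 x >] then h x else k x.
have l1 x : X1 x -> l x = h x by move=> /asboolP; rewrite /l => ->.
have l2 x : X2 x -> l x = k x.
  rewrite /l; case: asboolP => // x1 x2.
  by have : set0 x by rewrite -dis.
have lc : continuous l.
  apply/continuous_subspace_setT; rewrite -X12.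
  apply: withinU_continuous => //.
    apply: (@subspace_eq_continuous _ _ _ (h : X -> A)).
      by move=> x /set_mem x1; rewrite /from_subspace l1.
    by apply: continuous_subspaceT; exact: mor_continuous.
  apply: (@subspace_eq_continuous _ _ _ (k : X -> A)).
    by move=> x /set_mem x2; rewrite /from_subspace l2.
  by apply: continuous_subspaceT; exact: mor_continuous.
have lf : l \o @dmap X = @dmap A \o l.
  apply: funext => x /=; have : setT x by [].
  rewrite -X12 => -[xi|xi].
    rewrite (l1 x)// l1; last by rewrite -f1; exists x.
    exact: (congr1 (fun F => F x) (mor_commutes h)).
  rewrite (l2 x)// l2; last by rewrite -f2; exists x.
  exact: (congr1 (fun F => F x) (mor_commutes k)).
by exists (@Morphism X A l lc lf).
Qed.

Lemma dmap_continuous (A : dynsys) : continuous (@dmap A).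
Proof. by have [g []] := dmap_homeomorphism A. Qed.

Definition mor_dmap (A : dynsys) : morphism A A :=
  @Morphism A A (@dmap A) (@dmap_continuous A) erefl.

(** * Objects over a system, and skeletons *)

Section Isomorphic.
Variable C : category.
Implicit Types x y z : C.

Lemma isomorphic_refl x : isomorphic x x.
Proof. by exists (cat_id x), (cat_id x); rewrite cat_compIl. Qed.

Lemma isomorphic_trans x y z :
  isomorphic x y -> isomorphic y z -> isomorphic x z.
Proof.
move=> [u [v [vu uv]]] [u' [v' [vu' uv']]].
exists (cat_comp u' u), (cat_comp v v'); split.
  by rewrite cat_compA -(cat_compA v) vu' cat_compIr vu.
by rewrite cat_compA -(cat_compA u') uv cat_compIr uv'.
Qed.

Lemma isomorphic_sym x y : isomorphic x y -> isomorphic y x.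
Proof. by move=> [u [v [vu uv]]]; exists v, u. Qed.

End Isomorphic.

Section Objects.
Variable X : dynsys.
Implicit Types o : over_obj X.

Lemma over_sys_odometer_like o : odometer_like (calA_sys (over_sys o)).
Proof. exact: svalP (sval (over_sys o)). Qed.

Lemma exists_over_obj (A : dynsys) (h : morphism X A) : odometer_like A ->
  le_ultranat (Phi (periods A)) (Phi (periods X)) ->
  exists o : over_obj X, calA_sys (over_sys o) = A.
Proof.
move=> odA AX.
pose A1 : calA := exist _ A odA.
pose A2 : calA_over X := exist _ A1 AX.
by exists (@OverObj X A2 h).
Qed.

Lemma isomorphic_periods o1 o2 :
  @isomorphic (frakB X) o1 o2 ->
  periods (calA_sys (over_sys o1)) = periods (calA_sys (over_sys o2)).
Proof.
move=> [u [v _]]; rewrite eqEsubset; split; apply: periods_morphism.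
  exact: over_fun v.
exact: over_fun u.
Qed.

(** Such a u fixes every point of the image of X. *)
Lemma over_hom_id o (u : over_hom o o) : over_fun u = mor_id _.
Proof.
have [x _] := phase_nonempty X.
apply: (odometer_like_rigid (a := over_map o x));
  try exact: over_sys_odometer_like.
exact: (esym (congr1 (fun w : morphism X _ => w x) (over_commutes u))).
Qed.

(** The comparison morphism is chosen so that the triangle commutes at one point;
indecomposability of X propagates this to all points. *)
Lemma indecomposable_over_hom o1 o2 : indecomposable X ->
  Phi (periods (calA_sys (over_sys o1))) =
    Phi (periods (calA_sys (over_sys o2))) ->
  inhabited (over_hom o1 o2).
Proof.
move=> indX E12; have [x _] := phase_nonempty X.
have [|u ux] := @morphism_to_odometer_like (calA_sys (over_sys o1))
    _ (over_map o1 x) (over_map o2 x) (over_sys_odometer_like o2).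
  by rewrite E12 => p.
suff uh : over_map o2 = mor_comp u (over_map o1).
  exact: inhabits (OverHom uh).
apply: (odometer_like_morphism_eq (x0 := x)) => //.
exact: over_sys_odometer_like.
Qed.

Lemma indecomposable_isomorphic o1 o2 : indecomposable X ->
  Phi (periods (calA_sys (over_sys o1))) =
    Phi (periods (calA_sys (over_sys o2))) ->
  @isomorphic (frakB X) o1 o2.
Proof.
move=> indX E12.
have [u] := indecomposable_over_hom indX E12.
have [v] := indecomposable_over_hom indX (esym E12).
by exists u, v; split; apply: over_hom_eq; exact: over_hom_id.
Qed.

(** Twist the map of o by one step of the odometer on one of the two pieces of X.
An isomorphism from o to the twisted object is the identity, being so at a point
coming from the other piece, and then the odometer map fixes the points coming
from the twisted piece. *)
Lemma decomposable_not_isomorphic o : ~ indecomposable X ->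
  Phi (periods (calA_sys (over_sys o))) <> ultranatE ->
  exists2 o', over_sys o' = over_sys o & ~ @isomorphic (frakB X) o o'.
Proof.
move=> decX PhiE.
have [//|o'P] := pselect (exists2 o', over_sys o' = over_sys o &
  ~ @isomorphic (frakB X) o o').
exfalso; apply: decX => X1 X2 X12 dis c1 c2 f1 f2.
have [->|/set0P[x1 X1x]] := eqVneq X1 set0; first by left.
have [->|/set0P[x2 X2x]] := eqVneq X2 set0; first by right.
exfalso; have [l [l1 l2]] := glue_morphism (over_map o)
  (mor_comp (mor_dmap _) (over_map o)) X12 dis c1 c2 f1 f2.
apply: o'P; exists (@OverObj X (over_sys o) l) => // -[u _].
have lu x : l x = over_fun u (over_map o x) :=
  congr1 (fun w : morphism X _ => w x) (over_commutes u).
have odA := over_sys_odometer_like o.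
have u1 : over_fun u = mor_id _.
  apply: (odometer_like_rigid (a := over_map o x1)) => //.
  by rewrite -lu l1.
apply: PhiE; apply: (@Phi_fixed_point _ (over_map o x2)).
have := lu x2; rewrite l2// u1; exact.
Qed.

Section Skeletons.
Variables (A0 : calA_over X -> Prop) (hA0 : is_skeleton A0).
Variables (B0 : frakB' A0 -> Prop) (hB0 : is_skeleton B0).

(** Two steps: transport o along an isomorphism of its odometer to one in A0, then
replace the result by its representative in B0. *)
Lemma skeleton_representative o :
  exists b : frakB0' B0, @isomorphic (frakB X) o (sval (sval b)).
Proof.
have [A [[A0A [u [v [vu uv]]]] _]] := hA0 (over_sys o).
pose o' := @OverObj X A (mor_comp u (over_map o)).
have oo' : @isomorphic (frakB X) o o'.
  have uP : over_map o' = mor_comp u (over_map o) by [].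
  have vP : over_map o = mor_comp v (over_map o').
    apply: morphism_eq; apply: funext => x.
    exact: (esym (congr1 (fun w : morphism _ _ => w (over_map o x)) vu)).
  exists (@OverHom X o o' u uP), (@OverHom X o' o v vP).
  by split; exact: over_hom_eq.
pose c : frakB' A0 := exist _ o' A0A.
have [b [[B0b cb] _]] := hB0 c.
exists (exist _ b B0b); exact: isomorphic_trans oo' cb.
Qed.

Lemma skeleton_eq (b1 b2 : frakB0' B0) :
  @isomorphic (frakB X) (sval (sval b1)) (sval (sval b2)) -> b1 = b2.
Proof.
move=> b12; have [c [_ cU]] := hB0 (sval b1).
have E1 := cU _ (conj (svalP b1) (isomorphic_refl _)).
have E2 := cU _ (conj (svalP b2) b12).
have {c cU E1 E2 b12} := etrans (esym E1) E2.
case: b1 b2 => [b1 h1] [b2 h2] /= E12; case: _ / E12 h2 => h2.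
by rewrite (Prop_irrelevance h1 h2).
Qed.

End Skeletons.
End Objects.

Theorem corollary4p3 (X : dynsys)
    (A0 : calA_over X -> Prop) (hA0 : is_skeleton A0)
    (B0 : frakB' A0 -> Prop) (hB0 : is_skeleton B0)
    (hX : Phi (periods X) <> ultranatE)
    (N : ultranat) (hN : Sigma X N) (hNE : N <> ultranatE) :
  (exists b : frakB0' B0, Phi (periods (obj_sys b)) = N) /\
  ((exists! b : frakB0' B0, Phi (periods (obj_sys b)) = N) <->
   indecomposable X).
Proof.
have ex : exists b : frakB0' B0, Phi (periods (obj_sys b)) = N.
  have [x _] := phase_nonempty X.
  have [a _] := phase_nonempty (odometer (uodometer N)).
  have odN : odometer_like (odometer (uodometer N)).
    by exists (uodometer N); exact: isomorphic_refl.
  have NX : le_ultranat (Phi (periods (odometer (uodometer N))))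
      (Phi (periods X)).
    by rewrite Phi_uodometer.
  have [h _] := morphism_to_odometer_like x a odN NX.
  have [o oN] := exists_over_obj h odN NX.
  have [b ob] := skeleton_representative hA0 hB0 o.
  by exists b; rewrite /obj_sys -(isomorphic_periods ob) oN Phi_uodometer.
split=> //; split=> [[b [bN bU]]|indX]; last first.
  have [b bN] := ex; exists b; split=> // b' b'N.
  apply: (skeleton_eq hB0); apply: indecomposable_isomorphic => //.
  by rewrite -/(obj_sys b) -/(obj_sys b') bN b'N.
have [//|decX] := pselect (indecomposable X).
have bE : Phi (periods (obj_sys b)) <> ultranatE by rewrite bN.
have [o Eo nbo] := decomposable_not_isomorphic decX bE.
have [b' ob'] := skeleton_representative hA0 hB0 o.
exfalso; apply: nbo; apply: isomorphic_sym.
rewrite (bU b') //.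
by rewrite /obj_sys -(isomorphic_periods ob') Eo.
Qed.
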